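(* Let $D$ be a semilocal Prüfer domain that is not a field. Suppose that $\Gamma(D_P)$ is free for every $P\in\mathrm{Spec}_{\mathrm{hi}}(D)\setminus\mathrm{Max}(D)$. Then $\mathrm{Inv}(D)$ is free if and only if $\Gamma(D_M)$ is free for every $M\in\mathrm{Max}(D)$.
   Context: $\mathrm{Inv}(D)$ denotes the group of invertible fractional ideals of $D$ under multiplication. ''Free'' means free abelian. Semilocal means that the set $\mathrm{Max}(D)$ of maximal ideals is finite. A Prüfer domain is an integral domain all of whose localizations at primes are valuation domains. $\Gamma(V)$ denotes the value group of a valuation domain $V$ (trivial if $V$ is a field). A prime ideal $P$ of a Prüfer domain $D$ is a branching point for $\mathrm{Spec}(D)$ if there is a family $\Delta\subseteq\mathrm{Spec}(D)$ of pairwise incomparable primes, each strictly containing $P$, such that $P=\inf\Delta$ in $\mathrm{Spec}(D)$ ordered by containment. $\mathrm{Spec}_{\mathrm{hi}}(D)$ is the set consisting of $(0)$, the maximal ideals of $D$, and the branching points of $\mathrm{Spec}(D)$. *)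

(* Defs.v *)
From HB Require Import structures.
From mathcomp Require Import all_boot all_order all_algebra.
From mathcomp Require Import boolp classical_sets functions cardinality.
From mathcomp Require Import freeg.

Set Implicit Arguments.
Unset Strict Implicit.
Unset Printing Implicit Defensive.

Import Order.TTheory GRing.Theory.
Local Open Scope ring_scope.
Local Open Scope quotient_scope.
Local Open Scope classical_set_scope.

(* {freeg I} is the group of finite formal Z-linear combinations of I. *)
Definition free_abelian (G : zmodType) : Prop :=
  exists (I : choiceType) (f : {additive G -> {freeg I}}), bijective f.

Section Spectrum.
Variable D : idomainType.
Implicit Types P M : set D.

(* idealr_closed requires 1 \notin P: only proper ideals are considered. *)
Definition prime_ideal : set (set D) :=
  [set P | idealr_closed [in P] /\ prime_idealr_closed [in P]].

Definition maximal_ideal : set (set D) :=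
  [set M | idealr_closed [in M] /\
           forall J : set D, idealr_closed [in J] -> M `<=` J -> J = M].

Record Spec := MkSpec { spec_set :> set D; _ : spec_set \in prime_ideal }.

HB.instance Definition _ := [isSub for spec_set].
HB.instance Definition _ := [Choice of Spec by <:].
HB.instance Definition _ :=
  [SubChoice_isSubPOrder of Spec by <: with set_display].

Lemma Spec_leE (P Q : Spec) : (P <= Q)%O <-> P `<=` Q.
Proof. by rewrite -subsetEset -leEsub. Qed.

Definition Max : set Spec := [set M : Spec | maximal_ideal M].

(* No maximal ideal is lost by taking Max inside Spec. *)
Lemma maximal_prime M : maximal_ideal M -> prime_ideal M.
Proof.
move=> [idM maxM]; split=> // u v.
have [M0 M1 Mlin] := idM.
rewrite !inE => uvM; have [uM|uM] := pselect (M u); first by rewrite mem_set.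
apply/orP; right; rewrite inE.
pose J := [set x | exists a m, M m /\ x = a * u + m].
have MJ : M `<=` J by move=> x Mx; exists 0, x; rewrite mul0r add0r.
have Ju : J u by exists 1, 0; rewrite mul1r addr0; split=> //; exact/set_mem.
have [[a [m [Mm e]]]|J1] := pselect (J 1).
  rewrite -[v]mul1r e mulrDl -mulrA [m * v]mulrC.
  have Mvm : M (v * m).
    have := Mlin v m 0 (mem_set Mm) M0; rewrite addr0; exact: set_mem.
  exact/set_mem/(Mlin a _ _ (mem_set uvM) (mem_set Mvm)).
case: uM; suff <- : J = M by [].
apply: maxM => //; split.
- by apply/mem_set/MJ/set_mem.
- by apply/negP => /set_mem.
move=> a x y /set_mem[b [m [Mm ->]]] /set_mem[c [n [Mn ->]]].
apply/mem_set; exists (a * b + c), (a * m + n); split.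
  exact/set_mem/(Mlin a _ _ (mem_set Mm) (mem_set Mn)).
by rewrite mulrDr mulrDl mulrA !addrA; congr (_ + _); rewrite addrAC.
Qed.

Definition semilocal : Prop := finite_set Max.

Definition branching (P : Spec) : Prop :=
  exists Delta : set Spec,
    [/\ forall Q R, Delta Q -> Delta R -> Q != R -> (Q >< R)%O,
        forall Q, Delta Q -> (P < Q)%O
      & infimums Delta P].

Definition Spec_hi : set Spec :=
  [set P : Spec | [\/ \val P = [set 0], Max P | branching P]].

End Spectrum.

Arguments Max D : clear implicits.
Arguments Spec_hi D : clear implicits.

Section ValueGroup.
Variable K : fieldType.

Record subring := MkSubring {
  subring_set :> set K;
  _ : subring_set \in [set V : set K | subring_closed [in V]]
}.

HB.instance Definition _ := [isSub for subring_set].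

(* V is a valuation domain whose field of fractions is K. *)
Definition valuation_ring (V : subring) : Prop :=
  forall x : K, x != 0 -> \val V x \/ \val V x^-1.

Variable V : subring.

Let Kstar := {x : K | x != 0}.

(* x / y is a unit of V. *)
Definition same_value (x y : Kstar) : bool :=
  `[< \val V (\val x / \val y) /\ \val V (\val y / \val x) >].

Lemma subring1 : \val V 1.
Proof. by have /set_mem[V1 _ _] := valP V; exact: set_mem V1. Qed.

Lemma subringM (x y : K) : \val V x -> \val V y -> \val V (x * y).
Proof.
have /set_mem[_ _ VM] := valP V.
by move=> Vx Vy; apply: set_mem (VM x y _ _); exact: mem_set.
Qed.

Lemma same_value_refl : reflexive same_value.
Proof.
by move=> [x x0]; apply/asboolP; rewrite /= divff//; split; exact: subring1.
Qed.

Lemma same_value_sym : symmetric same_value.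
Proof. by move=> x y; apply/asboolP/asboolP => -[]. Qed.

Lemma same_value_trans : transitive same_value.
Proof.
move=> [y y0] [x x0] [z z0] /asboolP/=[xy yx] /asboolP/=[yz zy].
apply/asboolP => /=; split.
  by have := subringM xy yz; rewrite mulrA divfK.
by have := subringM zy yx; rewrite mulrA divfK.
Qed.

Canonical same_value_equiv :=
  EquivRel same_value same_value_refl same_value_sym same_value_trans.

(* The multiplicative group K^* / V^*, written additively. It is the value
   group of V when V is a valuation domain with field of fractions K. *)
Definition value_group := {eq_quot same_value}.

HB.instance Definition _ := EqQuotient.on value_group.
HB.instance Definition _ := Choice.on value_group.

Lemma same_value_repr (x : Kstar) :
  same_value x (repr (\pi_value_group x)).
Proof. by apply/eqmodP; rewrite reprK. Qed.

Definition Kstar1 : Kstar := exist _ 1 (oner_neq0 K).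
Definition KstarM (x y : Kstar) : Kstar :=
  exist _ (\val x * \val y) (mulf_neq0 (valP x) (valP y)).
Lemma KstarV_subproof (x : Kstar) : (\val x)^-1 != 0.
Proof. by rewrite invr_eq0 (valP x). Qed.
Definition KstarV (x : Kstar) : Kstar :=
  exist _ (\val x)^-1 (KstarV_subproof x).

Definition vg0 : value_group := lift_cst value_group Kstar1.
Canonical pi_vg0 := PiConst vg0.

Definition vgD := lift_op2 value_group KstarM.
Lemma pi_vgD : {morph \pi : x y / KstarM x y >-> vgD x y}.
Proof.
move=> x y; unlock vgD; apply/eqmodP/asboolP => /=.
have /asboolP[a b] := same_value_repr x.
have /asboolP[c d] := same_value_repr y.
by split; rewrite invfM mulrACA; exact: subringM.
Qed.
Canonical pi_vgD_morph := PiMorph2 pi_vgD.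

Definition vgN := lift_op1 value_group KstarV.
Lemma pi_vgN : {morph \pi : x / KstarV x >-> vgN x}.
Proof.
move=> x; unlock vgN; apply/eqmodP/asboolP => /=.
have /asboolP[a b] := same_value_repr x.
by rewrite !invrK; split; rewrite mulrC.
Qed.
Canonical pi_vgN_morph := PiMorph1 pi_vgN.

Lemma vgDA : associative vgD.
Proof.
elim/quotW=> x; elim/quotW=> y; elim/quotW=> z; rewrite !piE.
by congr \pi; apply: val_inj; rewrite /= mulrA.
Qed.

Lemma vgDC : commutative vgD.
Proof.
elim/quotW=> x; elim/quotW=> y; rewrite !piE.
by congr \pi; apply: val_inj; rewrite /= mulrC.
Qed.

Lemma vg0D : left_id vg0 vgD.
Proof.
elim/quotW=> x; rewrite !piE.
by congr \pi; apply: val_inj; rewrite /= mul1r.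
Qed.

Lemma vgND : left_inverse vg0 vgN vgD.
Proof.
elim/quotW=> x; rewrite !piE.
by congr \pi; apply: val_inj; rewrite /= mulVf // (valP x).
Qed.

HB.instance Definition _ :=
  GRing.isZmodule.Build value_group vgDA vgDC vg0D vgND.

End ValueGroup.

Section Localization.
Variable D : idomainType.
Local Notation K := {fraction D}.
Local Notation "x %:F" := (@FracField.tofrac D x).

Definition localization_set (P : Spec D) : set K :=
  [set x | exists a s : D, ~ \val P s /\ x = a%:F / s%:F].

Lemma localization_subring (P : Spec D) :
  subring_closed [in localization_set P].
Proof.
have /set_mem[[P0 P1 _] Pprime] := valP P.
have nz s : ~ \val P s -> s%:F != 0.
  by move=> Ps; rewrite tofrac_eq0; apply/eqP => s0; apply: Ps; rewrite s0;
     exact/set_mem.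
have PM s t : ~ \val P s -> ~ \val P t -> ~ \val P (s * t).
  by move=> Ps Pt /mem_set/Pprime/orP[]/set_mem.
split.
- apply/mem_set; exists 1, 1; rewrite divff ?oner_neq0 ?tofrac1 ?divr1//.
  by split=> // /mem_set P1'; rewrite [_ \in _]P1' in P1.
- move=> x y /set_mem[a [s [Ps ->]]] /set_mem[b [t [Pt ->]]].
  apply/mem_set; exists (a * t - b * s), (s * t); split; first exact: PM.
  by rewrite tofracB !tofracM -mulNr addf_div ?nz// mulNr.
- move=> x y /set_mem[a [s [Ps ->]]] /set_mem[b [t [Pt ->]]].
  apply/mem_set; exists (a * b), (s * t); split; first exact: PM.
  by rewrite !tofracM mulf_div.
Qed.

Definition localization (P : Spec D) : subring K :=
  MkSubring (mem_set (localization_subring P)).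

Definition prufer : Prop := forall P : Spec D, valuation_ring (localization P).

End Localization.

Section FractionalIdeals.
Variable D : idomainType.
Local Notation K := {fraction D}.
Local Notation "x %:F" := (@FracField.tofrac D x).
Implicit Types I J : set K.

Definition fractional_ideal : set (set K) :=
  [set I | [/\ I 0, forall x y, I x -> I y -> I (x + y),
               forall (a : D) x, I x -> I (a%:F * x),
               exists2 x, I x & x != 0
             & exists2 d : D, d != 0 &
                 forall x, I x -> exists a : D, d%:F * x = a%:F]].

Definition fidealM I J : set K :=
  [set x | exists2 s : seq (K * K),
     (forall p, p \in s -> I p.1 /\ J p.2) & x = \sum_(p <- s) p.1 * p.2].

Definition fideal1 : set K := range (@FracField.tofrac D).

Definition invertible : set (set K) :=
  [set I | fractional_ideal I /\
           exists2 J, fractional_ideal J & fidealM I J = fideal1].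

(* The group of invertible fractional ideals under multiplication, written
   additively: I + J is the product ideal, 0 is D and - I is I^-1. *)
Record InvGroup := MkInv { Inv_set :> set K; _ : Inv_set \in invertible }.

HB.instance Definition _ := [isSub for Inv_set].
HB.instance Definition _ := [Choice of InvGroup by <:].

Lemma fidealMC I J : fidealM I J = fidealM J I.
Proof.
suff H A B : fidealM A B `<=` fidealM B A by apply/seteqP; split; exact: H.
move=> x [s sP ->]; exists [seq (p.2, p.1) | p <- s].
  by move=> _ /mapP[p /sP[? ?] ->].
by rewrite big_map /=; apply: eq_bigr => p _; rewrite mulrC.
Qed.

Lemma fidealM_gen I J x y : I x -> J y -> fidealM I J (x * y).
Proof.
move=> Ix Jy; exists [:: (x, y)]; last by rewrite big_seq1.
by move=> p; rewrite inE => /eqP ->.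
Qed.

Lemma fidealM0 I J : fidealM I J 0.
Proof. by exists [::]; rewrite ?big_nil. Qed.

Lemma fidealMD I J x y : fidealM I J x -> fidealM I J y -> fidealM I J (x + y).
Proof.
move=> [s sP ->] [t tP ->]; exists (s ++ t); last by rewrite big_cat.
by move=> p; rewrite mem_cat => /orP[/sP|/tP].
Qed.

(* fidealM I J is the additive subgroup generated by the products. *)
Lemma fidealM_min I J (A : set K) :
  A 0 -> (forall x y, A x -> A y -> A (x + y)) ->
  (forall x y, I x -> J y -> A (x * y)) -> fidealM I J `<=` A.
Proof.
move=> A0 AD AM _ [s sP ->]; rewrite big_seq.
by apply: (big_ind A) => // p /sP[? ?]; exact: AM.
Qed.

Lemma fidealMA I J L : fidealM I (fidealM J L) = fidealM (fidealM I J) L.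
Proof.
have H A B C : fidealM (fidealM A B) C `<=` fidealM A (fidealM B C).
  apply: fidealM_min => [||x z]; [exact: fidealM0|exact: fidealMD|].
  move=> ABx Cz; move: x ABx.
  apply: (@fidealM_min _ _ [set x | fidealM A (fidealM B C) (x * z)]) => /=.
  - by rewrite mul0r; exact: fidealM0.
  - by move=> x y; rewrite mulrDl; exact: fidealMD.
  - by move=> x y Ax By; rewrite -mulrA; do 2?apply: fidealM_gen.
apply/seteqP; split; last exact: H.
by rewrite fidealMC (fidealMC J) (fidealMC _ L) (fidealMC I); exact: H.
Qed.

Lemma fideal1M I : fractional_ideal I -> fidealM fideal1 I = I.
Proof.
move=> [I0 ID IZ _ _]; apply/seteqP; split => [|x Ix].
  by apply: fidealM_min => // _ x [a _ <-]; exact: IZ.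
by rewrite -[x]mul1r; apply: fidealM_gen => //; exists 1; rewrite ?tofrac1.
Qed.

Lemma fractional_idealM I J : fractional_ideal I -> fractional_ideal J ->
  fractional_ideal (fidealM I J).
Proof.
move=> [I0 ID IZ [x Ix x0] [d d0 dI]] [J0 JD JZ [y Jy y0] [e e0 eJ]]; split.
- exact: fidealM0.
- by move=> ? ?; exact: fidealMD.
- move=> a; apply: fidealM_min => [||u v Iu Jv] /=.
  + by rewrite mulr0; exact: fidealM0.
  + by move=> ? ?; rewrite mulrDr; exact: fidealMD.
  + by rewrite mulrA; apply: fidealM_gen => //; exact: IZ.
- by exists (x * y); [exact: fidealM_gen|rewrite mulf_neq0].
- exists (d * e); first by rewrite mulf_neq0.
  apply: fidealM_min => [|u v [a ea] [b eb]|u v /dI[a ea] /eJ[b eb]] /=.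
  + by exists 0; rewrite mulr0 tofrac0.
  + by exists (a + b); rewrite mulrDr ea eb tofracD.
  + by exists (a * b); rewrite !tofracM mulrACA ea eb.
Qed.

Lemma fractional_ideal1 : fractional_ideal fideal1.
Proof.
split.
- by exists 0; rewrite ?tofrac0.
- by move=> _ _ [a _ <-] [b _ <-]; exists (a + b); rewrite ?tofracD.
- by move=> a _ [b _ <-]; exists (a * b); rewrite ?tofracM.
- by exists 1; [exists 1; rewrite ?tofrac1|exact: oner_neq0].
- exists 1; first exact: oner_neq0.
  by move=> _ [a _ <-]; exists a; rewrite tofrac1 mul1r.
Qed.

Lemma invertible1 : invertible fideal1.
Proof.
split; first exact: fractional_ideal1.
exists fideal1; first exact: fractional_ideal1.
exact/fideal1M/fractional_ideal1.
Qed.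

Lemma invertibleM I J : invertible I -> invertible J ->
  invertible (fidealM I J).
Proof.
move=> [fI [I' fI' II']] [fJ [J' fJ' JJ']]; split.
  exact: fractional_idealM.
exists (fidealM J' I'); first exact: fractional_idealM.
by rewrite -fidealMA [fidealM J _]fidealMA JJ' fideal1M.
Qed.

Lemma InvP (I : InvGroup) : invertible I. Proof. exact/set_mem/valP. Qed.

Lemma invertibleV (I : InvGroup) :
  {J | invertible J & fidealM J I = fideal1}.
Proof.
apply: cid2; have [fI [J fJ IJ]] := InvP I.
by exists J; [split=> //; exists (I : set K)|]; rewrite // fidealMC.
Qed.

Definition Inv1 : InvGroup := MkInv (mem_set invertible1).
Definition InvM (I J : InvGroup) : InvGroup :=
  MkInv (mem_set (invertibleM (InvP I) (InvP J))).
Definition InvV (I : InvGroup) : InvGroup :=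
  MkInv (mem_set (s2valP (invertibleV I))).

Lemma InvMA : associative InvM.
Proof. by move=> I J L; apply: val_inj; exact: fidealMA. Qed.

Lemma InvMC : commutative InvM.
Proof. by move=> I J; apply: val_inj; exact: fidealMC. Qed.

Lemma Inv1M : left_id Inv1 InvM.
Proof. by move=> I; apply: val_inj; apply: fideal1M; case: (InvP I). Qed.

Lemma InvVM : left_inverse Inv1 InvV InvM.
Proof. by move=> I; apply: val_inj; exact: s2valP' (invertibleV I). Qed.

HB.instance Definition _ :=
  GRing.isZmodule.Build InvGroup InvMA InvMC Inv1M InvVM.

End FractionalIdeals.

(* Main.v *)
From HB Require Import structures.
Require Import Defs.
From mathcomp Require Import all_boot all_order all_algebra.
From mathcomp Require Import boolp classical_sets functions cardinality.
From mathcomp Require Import wochoice freeg.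

(* For a maximal ideal M, the value in Gamma(D_M) of a generator of I D_M
   defines a homomorphism Inv(D) -> Gamma(D_M). These maps are jointly
   injective and there are finitely many, so Inv(D) embeds in the product of
   the Gamma(D_M), and subgroups of free abelian groups are free.

   Conversely fix M. For each other maximal ideal N let Q_N be the largest prime
   contained in both M and N: it is a branching point, witnessed by {M, N}, so
   Gamma(D_{Q_N}) is free, and D_{Q_N} = D_M D_N. Let H be the joint kernel of
   the maps Gamma(D_M) -> Gamma(D_{Q_N}). The quotient Gamma(D_M) / H embeds in
   a free group, so H is a direct summand with free complement. By an
   approximation argument every h in H is the M-component of a principal ideal
   whose other components vanish, so H embeds in the free group Inv(D). *)

Set Implicit Arguments.
Unset Strict Implicit.
Unset Printing Implicit Defensive.

Import GRing.Theory Num.Theory.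
Local Open Scope ring_scope.
Local Open Scope quotient_scope.
Local Open Scope classical_set_scope.

(** * Free abelian groups *)

Section WellOrder.
Context {T : eqType} {R : rel T} (woR : well_order R).

Let wo_chainR : wo_chain R predT.
Proof. by move=> A _; exact: woR. Qed.

Lemma well_order_total : total R.
Proof. by move=> x y; exact: (wo_chainW wo_chainR). Qed.

Lemma well_order_anti : antisymmetric R.
Proof. by move=> x y; exact: (wo_chain_antisymmetric wo_chainR). Qed.

(** The least element of {x, y, z} decides: if it is y or z, antisymmetry identifies it with its
    predecessor in the chain. *)
Lemma well_order_trans : transitive R.
Proof.
move=> y x z xy yz.
have [|m [[mA minm] _]] := @woR [in [:: x; y; z]] _.
  by exists x; rewrite !inE eqxx.
have mx : R m x by apply: minm; rewrite !inE eqxx.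
have my : R m y by apply: minm; rewrite !inE eqxx orbT.
have mz : R m z by apply: minm; rewrite !inE eqxx !orbT.
move: mA mx my mz; rewrite !inE => /or3P[] /eqP -> // *.
  by rewrite (@well_order_anti x y) ?xy.
by rewrite -(@well_order_anti y z) ?yz.
Qed.

Lemma well_order_ind (P : T -> Prop) :
  (forall x, (forall y, R y x -> y != x -> P y) -> P x) -> forall x, P x.
Proof.
move=> IH x; apply: contrapT => nPx.
have [|m [[/asboolP nPm minm] _]] := @woR [pred y | `[< ~ P y >]] _.
  by exists x; exact/asboolP.
apply: nPm; apply: IH => y ym; apply: contraNP => nPy.
by apply/eqP/well_order_anti; rewrite ym minm//; exact/asboolP.
Qed.

Lemma well_order_seq_max (s : seq T) : s != [::] ->
  exists2 m, m \in s & forall k, k \in s -> R k m.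
Proof.
have Rxx x : R x x by have := well_order_total x x; rewrite orbb.
elim: s => // x [_ _|y s IH _].
  by exists x; [exact: mem_head|move=> k; rewrite inE => /eqP ->].
have [//|m ms max_m] := IH.
have [xm|mx] := orP (well_order_total x m).
  exists m; first by rewrite inE ms orbT.
  by move=> k; rewrite inE => /orP[/eqP -> //|/max_m].
exists x; first exact: mem_head.
by move=> k; rewrite inE => /orP[/eqP -> //|/max_m/well_order_trans]; exact.
Qed.

End WellOrder.

(** * Universal property of free abelian groups *)

Section FreeLift.
Context {J : choiceType} {G : zmodType} (b : J -> G).

(** [fglift] needs a module over the coefficient ring; [zmodule] supplies the canonical action of
    the integers on G. *)
Definition freeg_lift : {freeg J} -> G := fglift (b : J -> zmodule G).

Lemma freeg_lift_is_additive : zmod_morphism freeg_lift.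
Proof. exact: (@lift_is_additive int J (zmodule G) b). Qed.

HB.instance Definition _ :=
  GRing.isZmodMorphism.Build {freeg J} G freeg_lift freeg_lift_is_additive.

Lemma freeg_liftU (k : int) j : freeg_lift << k *g j >> = b j *~ k.
Proof. exact: (@liftU int (zmodule G) J b). Qed.

Lemma freeg_liftE x :
  freeg_lift x = \sum_(z <- dom x) b z *~ coeff z x.
Proof.
rewrite -{1}[x]freeg_sumE raddf_sum; apply: eq_bigr => z _.
exact: freeg_liftU.
Qed.

End FreeLift.

Lemma freeg_ext (J : choiceType) (G : zmodType)
    (f g : {additive {freeg J} -> G}) :
  (forall j, f << j >> = g << j >>) -> f =1 g.
Proof.
move=> fg x; rewrite -[x]freeg_sumE !raddf_sum; apply: eq_bigr => z _.
by rewrite -[coeff z x]intz -freegU_mulz !raddfMz fg.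
Qed.

(* For each i consider the elements g of G such that f g is supported below i
   for a well-ordering of I. Choosing among them one with minimal nonzero i-th
   coordinate, whenever there is one, gives a basis of G modulo the kernel. *)
Lemma freeg_split (G : zmodType) (I : choiceType)
    (f : {additive G -> {freeg I}}) :
  exists (J : choiceType) (s : {additive {freeg J} -> G})
         (d : {additive G -> {freeg J}}),
    cancel s d /\ forall g, d g = 0 <-> f g = 0.
Proof.
have [R woR] := well_ordering_principle I.
have [c cE] : exists c : I -> {additive G -> int},
    forall i g, c i g = coeff i (f g).
  by exists (fun i => coeff i \o f).
have cM i g (n : int) : c i (g *~ n) = c i g * n.
  by rewrite raddfMz -mulrzr intz.
pose below i g := forall k, c k g != 0 -> R k i.
have belowB i g h : below i g -> below i h -> below i (g - h).
  move=> gi hi k; rewrite raddfB => nz.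
  have [g0|/gi//] := eqVneq (c k g) 0; apply: hi.
  by apply: contra nz => /eqP ->; rewrite g0 subr0.
have belowMz i g n : below i g -> below i (g *~ n).
  move=> gi k; rewrite cM mulf_eq0 => /norP[nz _]; exact: gi.
(* J collects the indices that occur as leading index of some f g. *)
pose J := {i | `[< exists2 g, below i g & c i g != 0 >]}.
have /choice[b bP] : forall j : J, exists b,
    [/\ below (val j) b, c (val j) b != 0
      & forall g, below (val j) g ->
          exists q, c (val j) g = c (val j) b * q].
  move=> [i /= /asboolP[g gi g0]].
  (* The i-th coordinates of elements below i form a subgroup of the integers. A nonzero one of
     least absolute value generates it: a nonzero remainder would be a smaller one. *)
  pose Q n := `[< exists2 h, below i h &
     c i h != 0 /\ `|c i h|%N = n >].
  have exQ : exists n, Q n.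
    by exists `|c i g|%N; apply/asboolP; exists g.
  case: (ex_minnP exQ) => n /asboolP[h hi [h0 hn]] minn.
  exists h; split => // g' gi'.
  set m := c i h in h0 hn *; set m' := c i g'.
  exists (m' %/ m)%Z; rewrite mulrC.
  rewrite [LHS](divz_eq m' m) -[RHS]addr0; congr (_ + _); apply/eqP.
  apply: contraT => r0.
  have : (n <= `|(m' %% m)%Z|)%N.
    apply: minn; apply/asboolP; exists (g' - h *~ (m' %/ m)%Z).
      by apply: belowB => //; exact: belowMz.
    suff -> : c i (g' - h *~ (m' %/ m)%Z) = (m' %% m)%Z by [].
    by apply/eqP; rewrite raddfB cM -/m -/m' mulrC subr_eq addrC -divz_eq.
  by rewrite leqNgt -hn -ltz_nat gez0_abs ?modz_ge0// ltz_mod.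
have [s sE] : exists s : {additive {freeg J} -> G}, s =1 freeg_lift b.
  by exists (freeg_lift b).
(* At the largest index j of the support of x, every other [b k] has coordinate 0, since it is
   supported below k and k is below j. So the j-th coordinate of f (s x) is a product of two nonzero
   integers. *)
have s_inj x : f (s x) = 0 -> x = 0.
  move=> fsx; apply/eqP; rewrite -dom_eq0; apply: contraT => domx.
  have domx' : [seq val z | z <- dom x] != [::] by case: (dom x) domx.
  have [m /mapP[j jx ->] maxj] := well_order_seq_max woR domx'.
  have [bj bj0 _] := bP j.
  have : c (val j) (s x) = 0.
    by rewrite cE; move/(congr1 (coeff (val j))): fsx; rewrite coeff0.
  rewrite sE freeg_liftE raddf_sum (bigD1_seq j) ?uniq_dom//=.
  rewrite big_seq_cond big1 => [|k /andP[kx kj]].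
    rewrite addr0 cM => /eqP; rewrite mulf_eq0 (negbTE bj0)/=.
    by move: jx; rewrite mem_dom => /negbTE ->.
  apply/eqP; rewrite cM mulf_eq0.
  apply/orP; left; apply: contraNT kj => nz; apply/eqP/val_inj.
  apply: (well_order_anti woR); rewrite maxj ?map_f//=.
  by have [bk _ _] := bP k; exact: bk.
(* Subtracting a multiple of [b j] kills the leading coordinate, so the leading index strictly
   decreases and well-founded induction applies. *)
have s_surj g : exists x, f (g - s x) = 0.
  have lead h : f h = 0 \/ exists i, below i h /\ c i h != 0.
    have [->|nz] := eqVneq (f h) 0; first by left.
    rewrite -dom_eq0 in nz; have [i ix maxi] := well_order_seq_max woR nz.
    right; exists i; split; last by rewrite cE -mem_dom.
    by move=> k; rewrite cE -mem_dom => /maxi.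
  have [fg|[i [gi g0]]] := lead g; first by exists 0; rewrite raddf0 subr0.
  move: i g gi g0; apply: (well_order_ind woR) => i IH g gi g0.
  have Ji : `[< exists2 g, below i g & c i g != 0 >].
    by apply/asboolP; exists g.
  pose j : J := exist _ i Ji.
  have [bj bj0 /(_ g gi) /= [q gq]] := bP j.
  have g'i : below i (g - b j *~ q) by apply: belowB => //; exact: belowMz.
  have s_j : s << q *g j >> = b j *~ q by rewrite sE freeg_liftU.
  have g'0 : c i (g - b j *~ q) = 0.
    by rewrite raddfB cM gq subrr.
  have [fg'|[i' [g'i' g'0']]] := lead (g - b j *~ q).
    by exists << q *g j >>; rewrite s_j.
  have [||x xP] := IH i' _ _ _ g'i' g'0'; first exact: g'i.
    by apply: contraNN g'0' => /eqP ->; rewrite g'0.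
  exists (<< q *g j >> + x).
  by rewrite [s _]raddfD opprD addrA s_j.
have {s_surj}[d dP] := choice s_surj.
(* Uniqueness makes the chosen d additive and a left inverse of s. *)
have d_uniq g x : f (g - s x) = 0 -> d g = x.
  move=> gx; apply/eqP; rewrite -subr_eq0; apply/eqP/s_inj.
  have -> : s (d g - x) = (g - s x) - (g - s (d g)).
    by rewrite raddfB opprB [RHS]addrC addrA subrK.
  by rewrite raddfB gx dP subrr.
have d_add : zmod_morphism d.
  move=> g h; apply: d_uniq.
  have -> : g - h - s (d g - d h) = (g - s (d g)) - (h - s (d h)).
    by rewrite [s _]raddfB !opprB -!addrA; congr (_ + _);
       rewrite [LHS]addrCA [RHS]addrCA [- h + _]addrC.
  by rewrite raddfB !dP subrr.
pose da := GRing.isZmodMorphism.Build G {freeg J} d d_add.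
pose d' : {additive G -> {freeg J}} := HB.pack d da.
exists J, s, d'; split => [x|g]; first by apply: d_uniq; rewrite subrr raddf0.
split => /= [dg|fg]; last by apply: d_uniq; rewrite raddf0 subr0.
by have := dP g; rewrite dg raddf0 subr0.
Qed.

(** Says that S is a subgroup and G / S embeds in a free abelian group, without forming the
    quotient. *)
Definition free_kernel (G : zmodType) (S : set G) : Prop :=
  exists (I : choiceType) (f : {additive G -> {freeg I}}),
    forall g, f g = 0 <-> S g.

(** From right to left this is the freeness of subgroups of free abelian groups: for injective f,
    the map d of [freeg_split] is injective too, hence inverse to s. *)
Lemma free_kernel0 (G : zmodType) : free_abelian G <-> free_kernel [set 0 : G].
Proof.
split=> [[I [f [h fh hf]]]|[I [f fP]]].
  exists I, f => g; split=> [fg|-> /=]; last exact: raddf0.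
  by rewrite /= -(fh g) fg -(raddf0 f) fh.
have [J [s [d [sd dP]]]] := freeg_split f.
exists J, d, s => // g; apply/eqP; rewrite -subr_eq0; apply/eqP.
by apply/fP/dP; rewrite raddfB sd subrr.
Qed.

Lemma free_kernel_preimage (G A : zmodType) (h : {additive G -> A})
    (S : set A) :
  free_kernel S -> free_kernel (h @^-1` S).
Proof. by move=> [I [f fP]]; exists I, (f \o h) => g; exact: fP. Qed.

Lemma free_kernelT (G : zmodType) : free_kernel [set: G].
Proof. by exists bool, \0 => g; split. Qed.

(** The two maps combine into one map to the direct sum, which is free on I + J; the projections
    recover each of them. *)
Lemma free_kernelI (G : zmodType) (S T : set G) :
  free_kernel S -> free_kernel T -> free_kernel (S `&` T).
Proof.
move=> [I [f fP]] [J [h hP]].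
pose inL : {additive {freeg I} -> {freeg (I + J)%type}} :=
  freeg_lift (fun i => << inl i >>).
pose inR : {additive {freeg J} -> {freeg (I + J)%type}} :=
  freeg_lift (fun j => << inr j >>).
pose prL : {additive {freeg (I + J)%type} -> {freeg I}} :=
  freeg_lift (fun s => if s is inl i then << i >> else 0).
pose prR : {additive {freeg (I + J)%type} -> {freeg J}} :=
  freeg_lift (fun s => if s is inr j then << j >> else 0).
have LL : prL \o inL =1 idfun.
  by apply: freeg_ext => i; rewrite /= !freeg_liftU.
have LR : prL \o inR =1 \0.
  by apply: freeg_ext => i; rewrite /= !freeg_liftU.
have RR : prR \o inR =1 idfun.
  by apply: freeg_ext => i; rewrite /= !freeg_liftU.
have RL : prR \o inL =1 \0.
  by apply: freeg_ext => i; rewrite /= !freeg_liftU.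
exists (I + J)%type, ((inL \o f) \+ (inR \o h)) => g.
split=> [fhg|[/fP fg /hP hg]]; last by rewrite /= fg hg !raddf0 addr0.
split; [apply/fP|apply/hP].
  have := congr1 prL fhg.
  by rewrite raddf0 [prL _]raddfD [X in X + _]LL [X in _ + X]LR addr0.
have := congr1 prR fhg.
by rewrite raddf0 [prR _]raddfD [X in X + _]RL [X in _ + X]RR add0r.
Qed.

Lemma free_kernel_bigI (G : zmodType) (T : eqType) (s : seq T)
    (F : T -> set G) :
  (forall t, t \in s -> free_kernel (F t)) ->
  free_kernel [set g | forall t, t \in s -> F t g].
Proof.
elim: s => [_|t s IH Fs].
  suff -> : [set g | forall t, t \in [::] -> F t g] = setT.
    exact: free_kernelT.
  by apply/seteqP; split.
suff -> : [set g | forall u, u \in t :: s -> F u g] =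
    F t `&` [set g | forall u, u \in s -> F u g].
  apply: free_kernelI; first by apply: Fs; rewrite mem_head.
  by apply: IH => u us; apply: Fs; rewrite inE us orbT.
apply/seteqP; split=> g /= => [Fg|[Ft Fg] u].
  by split=> [|u us]; apply: Fg; rewrite inE ?eqxx ?us ?orbT.
by rewrite inE => /orP[/eqP ->//|/Fg].
Qed.

(* The projection g |-> g - s (d g) onto S along the free complement given by
   freeg_split turns r into a homomorphism defined on all of G. *)
Lemma free_abelian_extension (G A : zmodType) (S : set G) (r : G -> A) :
  free_kernel S -> free_abelian A ->
  (forall g h, S g -> S h -> r (g - h) = r g - r h) ->
  (forall g, S g -> r g = 0 -> g = 0) -> free_abelian G.
Proof.
move=> [I [f fP]] /free_kernel0 freeA rB r0.
have [J [s [d [sd dP]]]] := freeg_split f.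
have dS g : d g = 0 <-> S g by rewrite dP fP.
have Sp g : S (g - s (d g)) by apply/dS; rewrite raddfB sd subrr.
pose h g := r (g - s (d g)).
have h_add : zmod_morphism h.
  move=> x y; rewrite /h -rB//; congr r.
  by rewrite [d _]raddfB [s _]raddfB !opprB -!addrA; congr (_ + _);
     rewrite [LHS]addrCA [RHS]addrCA [- y + _]addrC.
pose ha := GRing.isZmodMorphism.Build G A h h_add.
pose h' : {additive G -> A} := HB.pack h ha.
apply/free_kernel0.
(* The projection is the identity on S, so h' agrees there with r, whose only zero in S is 0. *)
suff -> : [set 0 : G] = S `&` (h' @^-1` [set 0]).
  by apply: free_kernelI; [exists I, f|exact: free_kernel_preimage].
apply/seteqP; split=> [_ ->|g [Sg hg]] /=.
  by split; [apply/dS; exact: raddf0|exact: (raddf0 h')].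
apply: r0 => //; move: hg; rewrite /= /h.
by move/dS: Sg => ->; rewrite raddf0 subr0.
Qed.

(** * Value groups and localizations *)

Section ValueGroupTheory.
Variables (K : fieldType) (V : subring K).
Local Notation Kstar := {x : K | x != 0}.

Lemma value_groupP (x y : Kstar) :
  \pi_(value_group V) x = \pi_(value_group V) y <->
  \val V (val x / val y) /\ \val V (val y / val x).
Proof.
split=> [/eqmodP/asboolP//|xy].
exact/eqmodP/asboolP.
Qed.

Lemma value_groupM (x y : Kstar) :
  \pi_(value_group V) (KstarM x y) =
  \pi_(value_group V) x + \pi_(value_group V) y.
Proof. by rewrite [RHS]/GRing.add /= piE. Qed.

Lemma value_groupV (x : Kstar) :
  \pi_(value_group V) (KstarV x) = - \pi_(value_group V) x.
Proof. by rewrite [RHS]/GRing.opp /= piE. Qed.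

Lemma value_group0P (x : Kstar) :
  \pi_(value_group V) x = 0 <-> \val V (val x) /\ \val V (val x)^-1.
Proof.
have -> : 0 = \pi_(value_group V) (Kstar1 K) by rewrite [LHS]/GRing.zero /= piE.
by rewrite value_groupP /= divr1 div1r.
Qed.

End ValueGroupTheory.

(** Units of V are units of W, so the identity of K^* induces a map of quotients. *)
Lemma value_group_hom (K : fieldType) (V W : subring K) : \val V `<=` \val W ->
  exists h : {additive value_group V -> value_group W},
    forall x : {x : K | x != 0},
      h (\pi_(value_group V) x) = \pi_(value_group W) x.
Proof.
move=> VW; pose h (g : value_group V) : value_group W :=
  \pi_(value_group W) (repr g).
have hE x : h (\pi_(value_group V) x) = \pi_(value_group W) x.
  have /value_groupP[a b] : \pi_(value_group V) (repr (\pi_(value_group V) x))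
     = \pi_(value_group V) x by rewrite reprK.
  by apply/value_groupP; split; exact: VW.
have h_add : zmod_morphism h.
  elim/quotW => x; elim/quotW => y.
  by rewrite -value_groupV -value_groupM !hE value_groupM value_groupV.
pose ha := GRing.isZmodMorphism.Build _ _ h h_add.
pose h' : {additive value_group V -> value_group W} := HB.pack h ha.
by exists h'.
Qed.

(** * Prime and maximal ideals *)

Section Primes.
Variable D : idomainType.
Implicit Types P Q M N : Spec D.
Local Notation K := {fraction D}.
Local Notation Kstar := {x : K | x != 0}.
Local Notation "x %:F" := (@FracField.tofrac D x).
Local Notation "P ^val" := (spec_set P) (at level 2, format "P ^val").

Lemma spec0 P : P^val 0.
Proof. by have /set_mem[[/set_mem P0 _ _] _] := valP P. Qed.

Lemma spec1 P : ~ P^val 1.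
Proof. by have /set_mem[[_ /negP P1 _] _] := valP P => /mem_set. Qed.

Lemma specMD P a x y : P^val x -> P^val y -> P^val (a * x + y).
Proof.
have /set_mem[[_ _ PD] _] := valP P.
by move=> /mem_set Px /mem_set Py; exact/set_mem/PD.
Qed.

Lemma specMl P a x : P^val x -> P^val (a * x).
Proof.
by move=> Px; rewrite -[a * x]addr0; apply: specMD => //; exact: spec0.
Qed.

Lemma specMr P a x : P^val x -> P^val (x * a).
Proof. by rewrite mulrC; exact: specMl. Qed.

Lemma specD P x y : P^val x -> P^val y -> P^val (x + y).
Proof. by move=> Px; rewrite -[x]mul1r; exact: specMD. Qed.

Lemma specB P x y : P^val x -> P^val y -> P^val (x - y).
Proof. by move=> Px Py; rewrite -mulN1r addrC; exact: specMD. Qed.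

Lemma specM P x y : P^val (x * y) -> P^val x \/ P^val y.
Proof.
have /set_mem[_ Pp] := valP P.
by move=> /mem_set/Pp/orP[]/set_mem; [left|right].
Qed.

Lemma specNM P x y : ~ P^val x -> ~ P^val y -> ~ P^val (x * y).
Proof. by move=> Px Py /specM[]. Qed.

Lemma spec_neq0 P x : ~ P^val x -> x != 0.
Proof. by apply: contra_notN => /eqP ->; exact: spec0. Qed.

Lemma Spec_exists (S : set D) : S 0 -> ~ S 1 ->
    (forall a x y, S x -> S y -> S (a * x + y)) ->
    (forall x y, S (x * y) -> S x \/ S y) ->
  exists P, P^val = S.
Proof.
move=> S0 S1 SD SM; suff PS : S \in @prime_ideal D by exists (MkSpec PS).
apply/mem_set; split; first split.
- exact/mem_set.
- by apply/negP => /set_mem.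
- by move=> a x y /set_mem Sx /set_mem Sy; exact/mem_set/SD.
- by move=> x y /set_mem/SM[] /mem_set ->; rewrite ?orbT.
Qed.

Lemma maximal_exists (J : set D) : J 0 -> ~ J 1 ->
    (forall a x y, J x -> J y -> J (a * x + y)) ->
  exists2 M, Max D M & J `<=` M^val.
Proof.
move=> J0 J1 JD.
pose lin (A : set D) := forall a x y, A x -> A y -> A (a * x + y).
(* The condition is put on the union with J because [Zorn_bigcup] also asks for the union of the
   empty chain, which does not contain J. *)
pose good := [set A : set D | lin (A `|` J) /\ ~ (A `|` J) 1].
have [F Fgood Ftot|A [[Alin A1] Amax]] := @Zorn_bigcup D good.
  split=> [a x y|[[A /Fgood[_ A1] FA]|//]]; last by apply: A1; left.
  have sub A : F A -> A `|` J `<=` \bigcup_(X in F) X `|` J.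
    by move=> FA z [Az|]; [left; exists A|right].
  have [[A FA]|F0] := pselect (exists A, F A); last first.
    move=> [[X FX]|Jx]; first by case: F0; exists X.
    move=> [[X FX]|Jy]; first by case: F0; exists X.
    by right; exact: JD.
  have memF z : (\bigcup_(X in F) X `|` J) z -> exists2 X, F X & (X `|` J) z.
    by move=> [[X FX Xz]|Jz]; [exists X => //; left|exists A => //; right].
  move=> /memF[X FX Xx] /memF[Y FY Yy].
  have [XY|YX] := Ftot _ _ FX FY.
    apply: (sub Y) => //; have [Ylin _] := Fgood _ FY; apply: Ylin => //.
    by case: Xx => [/XY|]; [left|right].
  apply: (sub X) => //; have [Xlin _] := Fgood _ FX; apply: Xlin => //.
  by case: Yy => [/YX|]; [left|right].
have maxM : maximal_ideal (A `|` J).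
  split=> [|B [/set_mem B0 /negP B1 Blin] AB].
    split; [by apply/mem_set; right|by apply/negP => /set_mem|].
    by move=> a x y /set_mem Ax /set_mem Ay; exact/mem_set/Alin.
  have BJ : B `|` J = B.
    by apply/seteqP; split=> [z [//|Jz]|z]; [apply: AB; right|left].
  have gB : good B.
    split; last by rewrite BJ => /mem_set.
    rewrite BJ => a x y /mem_set Bx /mem_set By; exact/set_mem/Blin.
  apply/seteqP; split=> // z Bz.
  apply: contrapT => nAz; apply: (Amax B) => //.
  split=> [u Au|BA]; first by apply: AB; left.
  by apply: nAz; left; exact: BA.
pose M := MkSpec (mem_set (maximal_prime maxM)).
by exists M => // z Jz; right.
Qed.

Lemma Max_sub_eq M N : Max D M -> M^val `<=` N^val -> M = N.
Proof.
move=> [_ maxM] MN; apply: val_inj => /=; apply/esym/maxM => //.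
by have /set_mem[] := valP N.
Qed.

Lemma MaxP M N : Max D M -> M != N -> exists2 x, M^val x & ~ N^val x.
Proof.
move=> maxM /eqP MN; apply: contrapT => nx; apply: MN.
apply: Max_sub_eq => // x Mx; apply: contrapT => Nx; apply: nx.
by exists x.
Qed.

End Primes.

Lemma subringD (K : fieldType) (V : subring K) (x y : K) :
  \val V x -> \val V y -> \val V (x + y).
Proof.
have /set_mem[V1 VB _] := valP V.
move=> /mem_set Vx /mem_set Vy; apply: set_mem.
have V0 : 0 \in [in \val V] by rewrite -(subrr 1); exact: (VB _ _ V1 V1).
have VN : - y \in [in \val V] by rewrite -[- y]add0r; exact: (VB _ _ V0 Vy).
by rewrite -[y]opprK; exact: (VB _ _ Vx VN).
Qed.

(** * Localizations and local generators of invertible ideals *)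

Section Localizations.
Variable D : idomainType.
Implicit Types P Q M N : Spec D.
Local Notation K := {fraction D}.
Local Notation Kstar := {x : K | x != 0}.
Local Notation "x %:F" := (@FracField.tofrac D x).
Local Notation "P ^val" := (spec_set P) (at level 2, format "P ^val").

Lemma locM P x y : localization_set P x -> localization_set P y ->
  localization_set P (x * y).
Proof. exact: (@subringM _ (localization P)). Qed.

Lemma locD P x y : localization_set P x -> localization_set P y ->
  localization_set P (x + y).
Proof. exact: (@subringD _ (localization P)). Qed.

Lemma loc_tofrac P a : localization_set P a%:F.
Proof. by exists a, 1; split; [exact: spec1|rewrite tofrac1 divr1]. Qed.

Lemma loc_inv P s : ~ P^val s -> localization_set P (s%:F)^-1.
Proof. by move=> Ps; exists 1, s; split=> //; rewrite tofrac1 div1r. Qed.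

Lemma not_mem_of_loc_inv P a : a != 0 -> localization_set P (a%:F)^-1 -> ~ P^val a.
Proof.
move=> a0 [b [s [Ps e]]] Pa.
have s0 : s%:F != 0 by rewrite tofrac_eq0; exact: spec_neq0 Ps.
have a0' : a%:F != 0 by rewrite tofrac_eq0.
suff sE : s = a * b by apply: Ps; rewrite sE; exact: specMr.
apply/eqP; rewrite -tofrac_eq tofracM; apply/eqP.
by rewrite -[b%:F](divfK s0) -e mulrA divff// mul1r.
Qed.

Lemma loc_sub P Q : Q^val `<=` P^val ->
  localization_set P `<=` localization_set Q.
Proof. by move=> QP x [a [s [Ps ->]]]; exists a, s; split => // /QP. Qed.

(** The denominators d with d x in D form an ideal. If it were proper, it would lie in a maximal
    ideal M, yet x in D_M has a denominator outside M. *)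
Lemma loc_Max x : (forall M, Max D M -> localization_set M x) -> @fideal1 D x.
Proof.
move=> locx; apply: contrapT => nx.
have [|||M maxM JM] := @maximal_exists D [set d | exists a, d%:F * x = a%:F].
- by exists 0; rewrite tofrac0 mul0r.
- by move=> [a]; rewrite tofrac1 mul1r => xa; apply: nx; exists a.
- move=> a u v [b ub] [c vc]; exists (a * b + c).
  by rewrite !tofracD !tofracM mulrDl -mulrA ub vc.
have [a [s [Ms xs]]] := locx _ maxM.
apply: (Ms); apply: JM; exists a; rewrite xs mulrC divfK// tofrac_eq0.
exact: spec_neq0 Ms.
Qed.

(** Write 1 as a sum of products a b with a in I and b in its inverse J. Not all of these lie in M;
    if a b = c is outside M, then y / a = (y b) / c is in D_M for every y in I. *)
Lemma inv_local_generator (I : InvGroup D) M :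
  exists a : Kstar, Inv_set I (val a) /\
    forall y, Inv_set I y -> localization_set M (y / val a).
Proof.
have [_ [J fJ IJ]] := InvP I.
have : fidealM I J 1 by rewrite IJ; exists 1; rewrite ?tofrac1.
move=> [s sIJ s1]; apply: contrapT => nogen.
have Mloc x : (exists2 p, p \in s & x = p.1 * p.2) ->
    exists2 c, M^val c & x = c%:F.
  move=> [[a b] ps ->] /=; have [/= Ia Jb] := sIJ _ ps.
  have : @fideal1 D (a * b) by rewrite -IJ; exact: fidealM_gen.
  move=> [c _ cE]; exists c => //; apply: contrapT => Mc; apply: nogen.
  have ab0 : a * b != 0 by rewrite -cE tofrac_eq0; exact: spec_neq0 Mc.
  have a0 : a != 0 by move: ab0; rewrite mulf_eq0 negb_or => /andP[].
  have b0 : b != 0 by move: ab0; rewrite mulf_eq0 negb_or => /andP[].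
  exists (exist _ a a0); split => // y Iy /=.
  have -> : y / a = (y * b) * (c%:F)^-1.
    by rewrite cE invfM mulrACA divff// mulr1.
  apply: locM; last exact: loc_inv.
  have : @fideal1 D (y * b) by rewrite -IJ; exact: fidealM_gen.
  by move=> [d _ <-]; exact: loc_tofrac.
have : exists2 c, M^val c & (1 : K) = c%:F.
  rewrite s1; rewrite big_seq.
  apply: (big_ind (fun x : K => exists2 c, M^val c & x = c%:F)).
  - by exists 0; [exact: spec0|rewrite tofrac0].
  - move=> _ _ [c Mc ->] [d Md ->]; exists (c + d); first exact: specD.
    by rewrite tofracD.
  - by move=> p ps; apply: Mloc; exists p.
move=> [c Mc]; rewrite -tofrac1 => /eqP; rewrite tofrac_eq => /eqP c1.
by apply: (@spec1 D M); rewrite c1.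
Qed.

(** Two local generators divide each other in D_M, so the value does not depend on the choice;
    products of generators generate the product ideal, which gives additivity. *)
Lemma inv_value_exists M :
  exists v : {additive InvGroup D -> value_group (localization M)},
    forall (I : InvGroup D) (a : Kstar), Inv_set I (val a) ->
      (forall y, Inv_set I y -> localization_set M (y / val a)) ->
      v I = \pi_(value_group (localization M)) a.
Proof.
have /choice[g gP] := fun I => inv_local_generator I M.
pose v (I : InvGroup D) : value_group (localization M) :=
  \pi_(value_group (localization M)) (g I).
have vE (I : InvGroup D) (a : Kstar) : Inv_set I (val a) ->
      (forall y, Inv_set I y -> localization_set M (y / val a)) ->
      v I = \pi_(value_group (localization M)) a.
  move=> Ia aI; have [Ig gI] := gP I.
  by apply/value_groupP; split; [exact: aI|exact: gI].
have vD I J : v (I + J) = v I + v J.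
  have [Ia aI] := gP I; have [Jb bJ] := gP J.
  rewrite -value_groupM; apply: vE => /=; first exact: fidealM_gen.
  apply: fidealM_min => [||x y Ix Jy] /=.
  - by rewrite mul0r -tofrac0; exact: loc_tofrac.
  - by move=> x y xM yM; rewrite mulrDl; exact: locD.
  - by rewrite invfM mulrACA; apply: locM; [exact: aI|exact: bJ].
have v_add : zmod_morphism v.
  by move=> I J; apply/eqP; rewrite eq_sym subr_eq -vD subrK.
pose va := GRing.isZmodMorphism.Build _ _ v v_add.
pose v' : {additive InvGroup D -> value_group (localization M)} := HB.pack v va.
by exists v'.
Qed.

Definition inv_value M :
    {additive InvGroup D -> value_group (localization M)} :=
  projT1 (cid (inv_value_exists M)).

Lemma inv_valueE M (I : InvGroup D) (a : Kstar) : Inv_set I (val a) ->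
  (forall y, Inv_set I y -> localization_set M (y / val a)) ->
  inv_value M I = \pi_(value_group (localization M)) a.
Proof. exact: (projT2 (cid (inv_value_exists M))). Qed.

(** Local generators that are units of D_M put I inside every D_M, hence inside D. If I were proper,
    it would lie in some M, but it contains a generator that is a unit of D_M. *)
Lemma inv_value_inj (I : InvGroup D) :
  (forall M, Max D M -> inv_value M I = 0) -> I = 0.
Proof.
move=> vI; apply: val_inj => /=; change (Inv_set I = @fideal1 D).
have [[I0 ID IZ _ _] _] := InvP I.
have gen M : Max D M -> exists a : Kstar, [/\ Inv_set I (val a),
    forall y, Inv_set I y -> localization_set M (y / val a),
    localization_set M (val a) & localization_set M (val a)^-1].
  move=> maxM; have [a [Ia aI]] := inv_local_generator I M.
  exists a; split => //; have := vI _ maxM; rewrite (inv_valueE Ia aI);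
  by move/value_group0P => [].
have ID1 : Inv_set I `<=` @fideal1 D.
  move=> y Iy; apply: loc_Max => M /gen[a [_ /(_ _ Iy) ya Ma _]].
  by rewrite -[y](divfK (valP a)); exact: locM.
apply/seteqP; split=> // _ [d _ <-].
suff I1 : Inv_set I 1 by rewrite -[d%:F]mulr1; exact: IZ.
apply: contrapT => nI1.
have [|||M maxM JM] := @maximal_exists D [set d | Inv_set I d%:F].
- by rewrite /= tofrac0.
- by rewrite /= tofrac1.
- by move=> a u v /= Iu Iv; rewrite tofracD tofracM; apply: ID => //; exact: IZ.
have [a [Ia _ _]] := gen _ maxM.
have [b _ ab] := ID1 _ Ia; rewrite -ab => /not_mem_of_loc_inv; apply.
  by rewrite -tofrac_eq0 ab (valP a).
by apply: JM; rewrite /= ab.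
Qed.

Lemma fraction_surj (x : K) :
  exists a b : D, b != 0 /\ x = a%:F / b%:F.
Proof.
elim/quotW: x => r; exists \n_r, \d_r; split; first exact: denom_ratioP.
unlock FracField.tofrac.
rewrite -[X in _ * X]FracField.pi_inv -[RHS]FracField.pi_mul.
rewrite /FracField.mulf /FracField.invf.
rewrite !numden_Ratio ?oner_eq0 ?denom_ratioP //.
by rewrite mulr1 mul1r Ratio_numden.
Qed.

Lemma principal_inv (x : Kstar) : exists I : InvGroup D,
  forall M, inv_value M I = \pi_(value_group (localization M)) x.
Proof.
pose pr (z : K) : set K := [set y | exists a : D, y = a%:F * z].
have pr_frac (z : Kstar) : fractional_ideal (pr (val z)).
  split.
  - by exists 0; rewrite tofrac0 mul0r.
  - by move=> _ _ [a ->] [b ->]; exists (a + b); rewrite tofracD mulrDl.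
  - by move=> a _ [b ->]; exists (a * b); rewrite tofracM mulrA.
  - by exists (val z); [exists 1; rewrite tofrac1 mul1r|exact: (valP z)].
  - have [a [b [b0 zE]]] := fraction_surj (val z).
    exists b => // _ [c ->]; exists (c * a).
    by rewrite zE tofracM mulrCA [a%:F / _]mulrC mulVKf // tofrac_eq0.
have prV : fidealM (pr (val x)) (pr (val x)^-1) = @fideal1 D.
  apply/seteqP; split.
    apply: fidealM_min => [||_ _ [a ->] [b ->]].
    - by exists 0; rewrite ?tofrac0.
    - by move=> _ _ [a _ <-] [b _ <-]; exists (a + b); rewrite ?tofracD.
    - by exists (a * b) => //; rewrite tofracM mulrACA divff ?mulr1// (valP x).
  move=> _ [a _ <-].
  rewrite -[a%:F](mulfK (valP x)); apply: fidealM_gen.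
    by exists a.
  by exists 1; rewrite tofrac1 mul1r.
have inv_x : pr (val x) \in @invertible D.
  apply/mem_set; split; first exact: pr_frac.
  by exists (pr (val x)^-1); first exact: (pr_frac (KstarV x)).
exists (MkInv inv_x) => M; apply: inv_valueE => [|_ [a ->]] /=.
  by exists 1; rewrite tofrac1 mul1r.
by rewrite mulfK ?(valP x)//; exact: loc_tofrac.
Qed.
End Localizations.

(** * Semilocal Prüfer domains *)

Section Prufer.
Variable D : idomainType.
Hypothesis prufer_D : prufer D.
Implicit Types P Q M N : Spec D.
Local Notation K := {fraction D}.
Local Notation Kstar := {x : K | x != 0}.
Local Notation "x %:F" := (@FracField.tofrac D x).
Local Notation "P ^val" := (spec_set P) (at level 2, format "P ^val").

(* Q is the complement of the saturation of (D \ M)(D \ N), so D_Q is the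
   compositum of D_M and D_N and Q is the largest prime inside both. *)
Lemma prufer_meet M N : exists Q, [/\ Q^val `<=` M^val, Q^val `<=` N^val &
  forall x, ~ Q^val x ->
    exists s t y, [/\ ~ M^val s, ~ N^val t & s * t = x * y]].
Proof.
pose S := [set x : D | forall s t y, ~ M^val s -> ~ N^val t -> s * t <> x * y].
have nS x : ~ S x -> exists s t y, [/\ ~ M^val s, ~ N^val t & s * t = x * y].
  move=> nSx; apply: contrapT => nst; apply: nSx => s t y Ms Nt e.
  by apply: nst; exists s, t, y.
have SM a x : S x -> S (a * x).
  by move=> Sx s t y Ms Nt; rewrite [a * x]mulrC -mulrA; exact: Sx.
(* Since D_M is a valuation ring, one of two nonzero elements divides the other there. If x / y = c
   / s, then s (x + y) = (c + s) y, so a multiple s' t of x + y makes s s' t a multiple of y. *)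
have SD x y : y != 0 -> localization_set M (x%:F / y%:F) -> S y -> S (x + y).
  move=> y0 [c [s [Ms e]]] Sy s' t z Ms' Nt st.
  have s0 : s%:F != 0 by rewrite tofrac_eq0; exact: spec_neq0 Ms.
  have y0' : y%:F != 0 by rewrite tofrac_eq0.
  have sx : s * x = c * y.
    apply/eqP; rewrite -tofrac_eq !tofracM; apply/eqP.
    by rewrite -[x%:F](divfK y0') e mulrA [s%:F * _]mulrC divfK.
  apply: (Sy (s * s') t ((c + s) * z)) => //; first exact: specNM.
  by rewrite -mulrA st mulrA mulrDr sx -mulrDl mulrCA mulrA.
have S0 : S 0.
  move=> s t y Ms Nt; rewrite mul0r; apply/eqP.
  by rewrite mulf_neq0//; [exact: spec_neq0 Ms|exact: spec_neq0 Nt].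
have [||||Q QS] := @Spec_exists D S.
- exact: S0.
- by move=> /(_ 1 1 1); rewrite mulr1; apply => //; exact: spec1.
- move=> a x y Sx Sy; have {}Sx := SM a _ Sx; move: (a * x) Sx => {}x Sx.
  have [->|x0] := eqVneq x 0; first by rewrite add0r.
  have [->|y0] := eqVneq y 0; first by rewrite addr0.
  have xy0 : x%:F / y%:F != 0 by rewrite mulf_neq0 ?invr_eq0 ?tofrac_eq0.
  have [xy|yx] := prufer_D M xy0; first exact: SD.
  by rewrite addrC; apply: SD => //; rewrite invfM invrK mulrC in yx.
- move=> x y Sxy; apply: contrapT => /not_orP[/nS[s [t [z [Ms Nt e]]]]].
  move=> /nS[s' [t' [z' [Ms' Nt' e']]]].
  apply: (Sxy (s * s') (t * t') (z * z')); try exact: specNM.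
  by rewrite mulrACA e e' mulrACA.
exists Q; rewrite QS; split => // x Sx; apply: contrapT => Mx.
  by apply: (Sx x 1 1) => //; exact: spec1.
by apply: (Sx 1 x 1); [exact: spec1| |rewrite mul1r mulr1].
Qed.

Definition meet M N : Spec D := projT1 (cid (prufer_meet M N)).

Lemma meetP M N : [/\ (meet M N)^val `<=` M^val, (meet M N)^val `<=` N^val &
  forall x, ~ (meet M N)^val x ->
    exists s t y, [/\ ~ M^val s, ~ N^val t & s * t = x * y]].
Proof. exact: (projT2 (cid (prufer_meet M N))). Qed.

Lemma meet_Spec_hi M N : Max D M -> Max D N -> M != N ->
  (Spec_hi D `\` Max D) (meet M N).
Proof.
move=> maxM maxN MN; have [QM QN Qmax] := meetP M N.
have nMN : ~ M^val `<=` N^val by move=> /(Max_sub_eq maxM)/eqP; exact/negP.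
have nNM : ~ N^val `<=` M^val.
  by move=> /(Max_sub_eq maxN)/esym/eqP; exact/negP.
split; last first.
  by move=> maxQ; apply: nMN; rewrite -(Max_sub_eq maxQ QM).
apply: Or33; exists [set M; N]; split.
- have cMN : (M >< N)%O.
    by apply/negP => /orP[] /Spec_leE.
  move=> _ _ [->|->] [->|->]; rewrite ?eqxx// => _.
  by rewrite Order.POrderTheory.comparable_sym.
- move=> _ [->|->]; rewrite Order.POrderTheory.lt_neqAle; apply/andP.
    split; last exact/Spec_leE.
    by apply/eqP => QeM; apply: nMN; rewrite -QeM.
  split; last exact/Spec_leE.
  by apply/eqP => QeN; apply: nNM; rewrite -QeN.
- split=> [_ [->|->]|R lR]; [exact/Spec_leE|exact/Spec_leE|].
  (* An x in R outside Q divides some s t with s outside M and t outside N; but R is prime and lies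
     in both. *)
  apply/Spec_leE => x Rx; apply: contrapT => /Qmax[s [t [y [Ms Nt e]]]].
  have RM : R^val `<=` M^val by apply/Spec_leE/lR; left.
  have RN : R^val `<=` N^val by apply/Spec_leE/lR; right.
  have : R^val (s * t) by rewrite e; exact: specMr.
  by move=> /specM[/RM|/RN].
Qed.

(** * Approximation at finitely many maximal ideals *)

Section Semilocal.
Variable s : seq (Spec D).
Hypothesis sMax : Max D = [set` s].

Let maxs N : N \in s -> Max D N. Proof. by rewrite sMax. Qed.

(** For each N other than M pick an element of N outside M; their product stays outside M because M
    is prime. *)
Lemma Max_separate M : Max D M ->
  exists2 e, ~ M^val e & forall N, N \in s -> N != M -> N^val e.
Proof.
move=> maxM; elim: s (maxs) => [_|N r IH maxr].
  by exists 1 => //; exact: spec1.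
have [|e Me re] := IH; first by move=> P Pr; apply: maxr; rewrite inE Pr orbT.
have [->|NM] := eqVneq N M.
  exists e => // P; rewrite inE => /orP[/eqP ->|]; last exact: re.
  by rewrite eqxx.
have [|x Nx Mx] := MaxP _ NM; first by apply: maxr; rewrite mem_head.
exists (x * e); first exact: specNM.
move=> P; rewrite inE => /orP[/eqP -> _|Pr PM]; first exact: specMr.
by apply: specMl; exact: re.
Qed.

(* As a is a unit of D_M D_N, some multiple t_N of a in D_M lies in D \ N. With
   e_N outside N and in all the other maximal ideals, take
   w = e_M a + \sum_(N != M) e_N t_N. *)
Lemma integral_approximation M (a : D) : Max D M -> a != 0 ->
  (forall N, N \in s -> N != M -> ~ (meet M N)^val a) ->
  exists w : D, [/\ w != 0, forall N, N \in s -> N != M -> ~ N^val w,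
    localization_set M (w%:F / a%:F) & localization_set M (a%:F / w%:F)].
Proof.
move=> maxM a0 Qa.
have Ms : M \in s by move: maxM; rewrite sMax.
have /choice[t tP] : forall N, exists t, N \in s -> N != M ->
    ~ N^val t /\ exists u b, ~ M^val u /\ u * t = a * b.
  move=> N; have [Ns|] := boolP (N \in s); last by exists 0.
  have [->|NM] := eqVneq N M; first by exists 0.
  have [_ _ /(_ _ (Qa _ Ns NM))[u [t [b [Mu Nt e]]]]] := meetP M N.
  by exists t => _ _; split => //; exists u, b.
have /choice[e eP] : forall N, exists e, N \in s -> ~ N^val e /\
    forall P, P \in s -> P != N -> P^val e.
  move=> N; have [Ns|] := boolP (N \in s); last by exists 0.
  by have [x Nx xP] := Max_separate (maxs Ns); exists x.
pose T N := if N == M then a else t N.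
(* [undup] lets each maximal ideal contribute once, so that its summand can be split off. *)
pose w := \sum_(N <- undup s) e N * T N.
have wE N : N \in s ->
    w = e N * T N + \sum_(P <- undup s | P != N) e P * T P.
  by move=> Ns; rewrite /w (bigD1_seq N) ?mem_undup ?undup_uniq.
(* Modulo N only the summand [e N * T N] survives, and neither factor is in N. *)
have wN N : N \in s -> N != M -> ~ N^val w.
  move=> Ns NM Nw.
  have : N^val (e N * T N).
    rewrite -[e N * _](addrK (\sum_(P <- undup s | P != N) e P * T P)) -wE//.
    apply: specB => //; rewrite big_seq_cond.
    apply: (big_ind N^val); [exact: spec0|by move=> *; exact: specD|].
    move=> P /andP[]; rewrite mem_undup => Ps PN; apply: specMr.
    by have [_] := eP P Ps; apply => //; rewrite eq_sym.
  rewrite /T (negbTE NM) => /specM[]; first by case: (eP N Ns).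
  by case: (tP N Ns NM).
(* In D_M the summands with P != M add up to a times an element c / u of the maximal ideal, as each
   e_P is in M and each t_P is a multiple of a. *)
have [u [c [Mu Mc uc]]] : exists u c, [/\ ~ M^val u, M^val c &
    u * (\sum_(P <- undup s | P != M) e P * T P) = a * c].
  rewrite big_seq_cond.
  apply: (big_ind (fun x =>
    exists u c, [/\ ~ M^val u, M^val c & u * x = a * c])).
  - by exists 1, 0; rewrite !mulr0; split=> //; [exact: spec1|exact: spec0].
  - move=> x y [u [c [Mu Mc ux]]] [v [d [Mv Md vy]]].
    exists (u * v), (v * c + u * d); split; first exact: specNM.
      by apply: specD; exact: specMl.
    by rewrite !mulrDr mulrAC ux -mulrA vy mulrCA [a * c * v]mulrAC -mulrA
       ![a * (_ * _)]mulrA [a * v]mulrC -!mulrA.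
  - move=> P /andP[]; rewrite mem_undup => Ps PM; rewrite /T (negbTE PM).
    have [_ [u [b [Mu ut]]]] := tP P Ps PM; exists u, (b * e P).
    split=> //; last by rewrite mulrCA ut mulrA mulrC.
    by apply: specMl; have [_] := eP P Ps; apply => //; rewrite eq_sym.
(* Now w = a v / u with u and v both outside M, so w and a are associates in D_M. *)
pose v := u * e M + c.
have Mv : ~ M^val v.
  move=> Mv; have : M^val (u * e M) by rewrite -[u * _](addrK c); exact: specB.
  by move=> /specM[//|]; case: (eP M Ms).
have uw : u * w = a * v.
  by rewrite (wE M)// /T eqxx mulrDr uc /v mulrDr mulrA [a * (_ * _)]mulrC.
have v0 : v%:F != 0 by rewrite tofrac_eq0; exact: spec_neq0 Mv.
have u0 : u%:F != 0 by rewrite tofrac_eq0; exact: spec_neq0 Mu.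
have a0' : a%:F != 0 by rewrite tofrac_eq0.
have wK : w%:F = a%:F * (v%:F / u%:F).
  by rewrite mulrA -tofracM -uw tofracM mulrC mulKf.
exists w; split=> //; first by rewrite -tofrac_eq0 wK !mulf_neq0 ?invr_eq0.
  by rewrite wK mulrC mulKf//; exists v, u.
by rewrite wK invfM mulVKf// invf_div; exists u, v.
Qed.

(** Up to inverting x and w, x is in D_M, say x = a / u with u outside M. Then a has the value of x
    at M and, like x and u, is a unit at each [meet M N], so the integral case applies to it. *)
Lemma approximation M (x : Kstar) : Max D M ->
  (forall N, N \in s -> N != M ->
     \pi_(value_group (localization (meet M N))) x = 0) ->
  exists w : Kstar,
    \pi_(value_group (localization M)) w =
      \pi_(value_group (localization M)) x /\
    forall N, N \in s -> N != M -> \pi_(value_group (localization N)) w = 0.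
Proof.
move=> maxM.
wlog: x / localization_set M (val x) => [wlogx xP|[a [u [Mu xE]]] xP].
  have [|Mx] := prufer_D M (valP x); first by move/wlogx; apply.
  have [|N Ns NM|w [wx wN]] := wlogx (KstarV x); first exact: Mx.
    by rewrite value_groupV xP ?oppr0.
  exists (KstarV w); rewrite !value_groupV wx value_groupV opprK; split => //.
  by move=> N Ns NM; rewrite value_groupV wN ?oppr0.
have u0 : u%:F != 0 by rewrite tofrac_eq0; exact: spec_neq0 Mu.
have aE : a%:F = val x * u%:F by rewrite xE divfK.
have a0' : a%:F != 0 by rewrite aE mulf_neq0 // (valP x).
have a0 : a != 0 by rewrite -tofrac_eq0.
have [N Ns NM|w [w0 wN wa aw]] := integral_approximation maxM a0.
  have [QM _ _] := meetP M N.
  have /value_group0P[_ xV] := xP N Ns NM.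
  apply: not_mem_of_loc_inv => //; rewrite aE invfM; apply: locM => //.
  by apply: loc_inv => /QM.
have w0' : w%:F != 0 by rewrite tofrac_eq0.
exists (exist _ w%:F w0'); split.
  apply/value_groupP; rewrite /= xE invfM invrK; split.
    by rewrite mulrA; apply: locM => //; exact: loc_tofrac.
  by rewrite mulrAC; apply: locM => //; exact: loc_inv.
move=> N Ns NM; apply/value_group0P; split; first exact: loc_tofrac.
by apply: loc_inv; exact: wN.
Qed.

Lemma Inv_free_of_Gamma :
  (forall M, Max D M -> free_abelian (value_group (localization M))) ->
  free_abelian (InvGroup D).
Proof.
move=> freeM; apply/free_kernel0.
suff -> : [set 0] = [set I : InvGroup D |
    forall M, M \in s -> (inv_value M @^-1` [set 0]) I].
  apply: free_kernel_bigI => M Ms; apply: free_kernel_preimage.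
  by apply/free_kernel0/freeM; rewrite sMax.
apply/seteqP; split=> [_ -> M Ms|I vI]; first exact: raddf0.
by apply: inv_value_inj => M; rewrite sMax => /vI.
Qed.

Lemma meet_hom_exists M N :
  exists h : {additive value_group (localization M) ->
      value_group (localization (meet M N))},
    forall x : Kstar, h (\pi_(value_group (localization M)) x) =
      \pi_(value_group (localization (meet M N))) x.
Proof. by apply: value_group_hom; apply: loc_sub; case: (meetP M N). Qed.

Definition meet_hom M N := projT1 (cid (meet_hom_exists M N)).

Lemma meet_homE M N (x : Kstar) :
  meet_hom M N (\pi_(value_group (localization M)) x) =
  \pi_(value_group (localization (meet M N))) x.
Proof. exact: (projT2 (cid (meet_hom_exists M N))). Qed.

Lemma Gamma_free_of_Inv M :
  (forall P, (Spec_hi D `\` Max D) P ->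
     free_abelian (value_group (localization P))) ->
  free_abelian (InvGroup D) -> Max D M ->
  free_abelian (value_group (localization M)).
Proof.
move=> free_hi free_inv maxM.
have Ms : M \in s by move: maxM; rewrite sMax.
pose S := [set g | forall N, N \in [seq N <- s | N != M] ->
  (meet_hom M N @^-1` [set 0]) g].
have freeS : free_kernel S.
  apply: free_kernel_bigI => N; rewrite mem_filter => /andP[NM Ns].
  apply: free_kernel_preimage; apply/free_kernel0/free_hi/meet_Spec_hi => //.
    exact: maxs.
  by rewrite eq_sym.
(* S is the joint kernel H. Off S the value of r is the irrelevant default 0. *)
have /choice[r rP] : forall g, exists I : InvGroup D, S g ->
    inv_value M I = g /\
    forall N, N \in s -> N != M -> inv_value N I = 0.
  move=> g; have [Sg|nSg] := pselect (S g); last by exists 0.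
  have [|w [wM wN]] := @approximation M (repr g) maxM.
    move=> N Ns NM; rewrite -meet_homE reprK; apply: (Sg N).
    by rewrite mem_filter NM.
  have [I vI] := principal_inv w; exists I => _.
  by rewrite vI wM reprK; split=> // N Ns NM; rewrite vI wN.
(* Although r comes from a choice, it is additive on S: an invertible ideal is determined by its
   values, and here they are prescribed at every maximal ideal. *)
apply: (free_abelian_extension (r := r) freeS free_inv) => [g h Sg Sh|g Sg rg].
  have Sgh : S (g - h).
    by move=> N Ns /=; rewrite raddfB (Sg N Ns) (Sh N Ns) subrr.
  have [vg og] := rP g Sg; have [vh oh] := rP h Sh; have [vd od] := rP _ Sgh.
  apply/eqP; rewrite -subr_eq0; apply/eqP/inv_value_inj => N.
  rewrite sMax => Ns; rewrite 2!raddfB.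
  have [->|NM] := eqVneq N M; first by rewrite vg vh vd subrr.
  by rewrite og// oh// od// !subr0.
by have [<- _] := rP g Sg; rewrite rg raddf0.
Qed.

End Semilocal.
End Prufer.

Theorem proposition6p10 (D : idomainType)
  (prufer_D : prufer D)
  (semilocal_D : semilocal D)
  (not_field_D : ~ GRing.field_axiom D)
  (free_hi : forall P : Spec D, (Spec_hi D `\` Max D) P ->
     free_abelian (value_group (localization P))) :
  free_abelian (InvGroup D) <->
  (forall M : Spec D, Max D M -> free_abelian (value_group (localization M))).
Proof.
have /finite_seqP[s sMax] := semilocal_D.
split=> [freeI M maxM|freeM]; last exact: Inv_free_of_Gamma sMax freeM.
exact: (Gamma_free_of_Inv prufer_D sMax free_hi freeI maxM).
Qed.
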